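(* Consider the forward Euler DG update $u_h^{n+1,(\mathrm{pre})}=u_h^n+\Delta t\,\mathcal L_h(u_h^n)$, $u_h^n\in V_h^k$, under the CFL conditions listed in the context. Let $\bar u_i^{n+1}$ be the cell average of $u_h^{n+1,(\mathrm{pre})}$ on $I_i$, and set $$\mathcal U^{\mathrm{1st}}=\mathcal U(\bar u_i^{n+1}),\qquad \mathcal U^{\mathrm{high}}=\tilde{\mathcal U}_i^{n+1,(\mathrm{pre})},\qquad \mathcal U^{\mathrm{up}}=\tilde{\mathcal U}_i^n-\lambda\big(\hat{\mathcal F}_{i+1/2}-\hat{\mathcal F}_{i-1/2}\big).$$ Then the entropy stable (ES) limiter $$u_h^{n+1}|_{I_i}=\bar u_i^{n+1}+\theta_i\big(u_h^{n+1,(\mathrm{pre})}|_{I_i}-\bar u_i^{n+1}\big),\qquad \theta_i=\min\Big\{\frac{\mathcal U^{\mathrm{up}}-\mathcal U^{\mathrm{1st}}}{\mathcal U^{\mathrm{high}}-\mathcal U^{\mathrm{1st}}},\,1\Big\}$$ (with $\theta_i=1$ if $\mathcal U^{\mathrm{high}}=\mathcal U^{\mathrm{1st}}$) satisfies $$\tilde{\mathcal U}_i^{n+1}\le \mathcal U^{\mathrm{up}}.$$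
   Context: Scalar conservation law $u_t+f(u)_x=0$, $x\in\mathbb R$, $t>0$. Uniform mesh: $\mathbb R=\bigcup_{i\in\mathbb Z}I_i$, $I_i=[x_{i-1/2},x_{i+1/2}]$ of length $\Delta x$; time step $\Delta t$, $\lambda=\Delta t/\Delta x$. $V_h^k$ is the space of functions whose restriction to each $I_i$ is a polynomial of degree at most $k$; $w_{i+1/2}^{-}$, $w_{i+1/2}^{+}$ are the traces of $w$ at $x_{i+1/2}$ from $I_i$ and $I_{i+1}$. Numerical flux: $\hat f(u^-,u^+)$ is a consistent, Lipschitz continuous and monotone numerical flux; its partial derivatives in the first and second argument are denoted $\hat f_1\ge0$ and $\hat f_2\le0$. The flux employed is the Lax–Friedrichs flux $\hat f(u^-,u^+)=\frac12(f(u^+)+f(u^-))-\frac12\alpha(u^+-u^-)$, $\alpha=\max|f'(u)|$ over $u$ between $u^-$ and $u^+$. With $\hat f_{i+1/2}=\hat f(u_{h,i+1/2}^-,u_{h,i+1/2}^+)$, the DG operator $\mathcal L_h(u_h)\in V_h^k$ is defined by $$\int_{I_i}\mathcal L_h(u_h)\,w\,dx=\int_{I_i}f(u_h)w_x\,dx-\hat f_{i+1/2}w_{i+1/2}^-+\hat f_{i-1/2}w_{i-1/2}^+\quad\forall w\in V_h^k,\ \forall i.$$ Entropy pair: $\mathcal U$ is convex and $C^2$, $\mathcal F'=\mathcal U'f'$. $\hat{\mathcal F}(u^-,u^+)$ is a proper numerical entropy flux associated with $\hat f$: $\hat{\mathcal F}(u,u)=\mathcal F(u)$ and $\partial\hat{\mathcal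 F}/\partial u^\pm=\mathcal U'(u^\pm)\,\partial\hat f/\partial u^\pm$ (for the Lax–Friedrichs flux, $\hat{\mathcal F}(u^-,u^+)=\frac12(\mathcal F(u^+)+\mathcal F(u^-))-\frac12\alpha(\mathcal U(u^+)-\mathcal U(u^-))$). Quadrature: $2N-3\ge k$; $\int_{I_i}^{\langle N\rangle}g\,dx=\Delta x\sum_{q=1}^N\omega_q g(\hat x_{i,q})$ is the $N$-point Gauss–Lobatto rule on $I_i$, with weights $\omega_q$ normalized to the unit interval (so $\sum_q\omega_q=1$). For a piecewise polynomial, the cell entropy is $\tilde{\mathcal U}_i=\frac1{\Delta x}\int_{I_i}^{\langle N\rangle}\mathcal U(\cdot)\,dx$; $\tilde{\mathcal U}_i^n$, $\tilde{\mathcal U}_i^{n+1,(\mathrm{pre})}$, $\tilde{\mathcal U}_i^{n+1}$ are the cell entropies of $u_h^n$, $u_h^{n+1,(\mathrm{pre})}$, $u_h^{n+1}$. Notation at level $n$: $\hat{\mathcal F}_{i+1/2}=\hat{\mathcal F}(u_{i+1/2}^{n,-},u_{i+1/2}^{n,+})$, $\hat f_i=\hat f(u_{i-1/2}^{n,+},u_{i+1/2}^{n,-})$, $\hat{\mathcal F}_i=\hat{\mathcal F}(u_{i-1/2}^{n,+},u_{i+1/2}^{n,-})$, and $(\hat f_1)_{i+1/2},(\hat f_2)_{i+1/2}$, $(\hat f_1)_i,(\hat f_2)_i$ are the partial derivatives evaluated at the corresponding arguments. CFL conditions (for all $i$): $\lambda\le(\hat f_1)_{i+1/2}-(\hat f_2)_i$,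 $\ \lambda\le(\hat f_1)_i-(\hat f_2)_{i-1/2}$, $$\lambda\le\frac{2\omega_N}{\max_x\mathcal U''(u_h^n)}\,\frac{\mathcal U'(u_{i+1/2}^{n,-})(\hat f_{i+1/2}-\hat f_i)-\hat{\mathcal F}_{i+1/2}+\hat{\mathcal F}_i}{(\hat f_{i+1/2}-\hat f_i)^2},$$ $$\lambda\le\frac{2\omega_1}{\max_x\mathcal U''(u_h^n)}\,\frac{\mathcal U'(u_{i-1/2}^{n,+})(\hat f_i-\hat f_{i-1/2})-\hat{\mathcal F}_i+\hat{\mathcal F}_{i-1/2}}{(\hat f_i-\hat f_{i-1/2})^2}.$$
   Formalization: In the last two CFL conditions the maximum of U'' is a finite supremum over the values of u_h^n and the states swept by the end-point updates u − (λ/ω)·(flux difference) of all cells; with only the values of u_h^n the claim is false. Zero denominators impose no restriction. *)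

(* Defs.v *)
From HB Require Import structures.
From mathcomp Require Import all_boot all_order all_algebra.
From mathcomp Require Import all_classical all_reals all_analysis.

Set Implicit Arguments.
Unset Strict Implicit.
Unset Printing Implicit Defensive.

Import Order.TTheory GRing.Theory Num.Theory.
Import numFieldNormedType.Exports.

Local Open Scope classical_set_scope.
Local Open Scope ring_scope.

Section Continuous_problem.
Context {R : realType}.
Implicit Types f U F : R -> R.

Definition C1 f : Prop :=
  (forall u : R, derivable f u 1) /\ continuous (derive1 f).

Definition C2 f : Prop :=
  (forall u : R, derivable f u 1) /\ C1 (derive1 f).

Definition entropy_pair f U F : Prop :=
  [/\ convex_function (setT : set R) U, C2 U &
      forall u : R, is_derive u 1 F (derive1 U u * derive1 f u)].

Definition between (a b : R) : set R := `[Num.min a b, Num.max a b].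

(* The flux [fh] and the numerical entropy flux [Fh] are functions of (u-, u+);
   [fh1] and [fh2] are the partial derivatives of [fh]. Their signs express
   monotonicity. Lipschitz continuity is required on bounded sets, which
   covers globally Lipschitz fluxes. *)
Definition proper_flux f U F (fh Fh fh1 fh2 : R -> R -> R) : Prop :=
  [/\ (forall u, fh u u = f u) /\ (forall u, Fh u u = F u),
      (forall K : set (R * R), bounded_set K ->
         [lipschitz fh z.1 z.2 | z in K]),
      (forall a b : R, is_derive a 1 (fun s => fh s b) (fh1 a b) /\
                      is_derive b 1 (fun s => fh a s) (fh2 a b)),
      (forall a b, 0 <= fh1 a b /\ fh2 a b <= 0) &
      (forall a b : R,
         is_derive a 1 (fun s => Fh s b) (derive1 U a * fh1 a b) /\
         is_derive b 1 (fun s => Fh a s) (derive1 U b * fh2 a b))].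

Definition LF_speed f (a b : R) : R :=
  sup [set `|derive1 f s| | s in between a b].

Definition LF_form (phi psi : R -> R) (alpha a b : R) : R :=
  2^-1 * (phi b + phi a) - 2^-1 * alpha * (psi b - psi a).

(* The coefficient alpha depends on (u-, u+) and need not be differentiable:
   it is frozen at its value when partial derivatives are taken, and it is for
   this derivative that the numerical entropy flux is compatible with the
   numerical flux. *)
Definition LF_flux f U F (fh Fh fh1 fh2 : R -> R -> R) : Prop :=
  forall a b : R, let alpha := LF_speed f a b in
  [/\ fh a b = LF_form f id alpha a b,
      Fh a b = LF_form F U alpha a b,
      is_derive a 1 (fun s => LF_form f id alpha s b) (fh1 a b) &
      is_derive b 1 (fun s => LF_form f id alpha a s) (fh2 a b)].

Definition numerical_flux f U F (fh Fh fh1 fh2 : R -> R -> R) : Prop :=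
  proper_flux f U F fh Fh fh1 fh2 \/ LF_flux f U F fh Fh fh1 fh2.

End Continuous_problem.

Section Discretization.
Context {R : realType}.
Variables (x0 dx : R).
Implicit Types (w u Lu : int -> {poly R}) (i : int) (k N q : nat).

(* x_{i-1/2} *)
Definition node i : R := x0 + dx * i%:~R.

Definition cell i : set R := `[node i, node (i + 1)].

(* A piecewise polynomial is the family of its restrictions to the cells; this
   keeps both traces at the interfaces. *)
Definition Vh k w : Prop := forall i, (size (w i) <= k.+1)%N.

(* w_{i+1/2}^- and w_{i+1/2}^+ *)
Definition trace_m w i : R := (w i).[node (i + 1)].
Definition trace_p w i : R := (w (i + 1)).[node (i + 1)].

(* g_{i+1/2} = g(u_{i+1/2}^-, u_{i+1/2}^+); g_{i-1/2} is [iface g u (i - 1)] *)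
Definition iface (g : R -> R -> R) u i : R := g (trace_m u i) (trace_p u i).

(* g_i = g(u_{i-1/2}^+, u_{i+1/2}^-) *)
Definition incell (g : R -> R -> R) u i : R :=
  g (trace_p u (i - 1)) (trace_m u i).

Definition DG_operator k (f : R -> R) (fh : R -> R -> R) u Lu : Prop :=
  Vh k Lu /\
  forall w, Vh k w -> forall i,
    \int[lebesgue_measure]_(x in cell i) ((Lu i).[x] * (w i).[x]) =
    \int[lebesgue_measure]_(x in cell i) (f (u i).[x] * (deriv (w i)).[x])
      - iface fh u i * trace_m w i + iface fh u (i - 1) * trace_p w (i - 1).

Definition cell_average w i : R :=
  dx^-1 * \int[lebesgue_measure]_(x in cell i) (w i).[x].

(* Nodes [xi q] and weights [om q], q = 1, .., N, on the unit interval: the rule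
   using both end points and exact up to degree 2N - 3. *)
Definition gauss_lobatto N (xi om : nat -> R) : Prop :=
  [/\ xi 1%N = 0, xi N = 1,
      (forall p q, (0 < p)%N -> (p < q)%N -> (q <= N)%N -> xi p < xi q) &
      (forall p : {poly R}, (size p <= 2 * N - 2)%N ->
         \sum_(1 <= q < N.+1) om q * p.[xi q] =
         \int[lebesgue_measure]_(x in `[0%R, 1%R]) p.[x])].

Definition lobatto_integral N (xi om : nat -> R) (g : R -> R) i : R :=
  dx * \sum_(1 <= q < N.+1) om q * g (node i + dx * xi q).

Definition cell_entropy N (xi om : nat -> R) (U : R -> R) w i : R :=
  dx^-1 * lobatto_integral N xi om (fun x => U (w i).[x]) i.

(* End-point states of cell i after the splitting of the forward Euler step over
   the quadrature nodes: u - lambda / omega * (flux difference). *)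
Definition right_update (lam omN : R) (fh : R -> R -> R) u i : R :=
  trace_m u i - lam / omN * (iface fh u i - incell fh u i).
Definition left_update (lam om1 : R) (fh : R -> R -> R) u i : R :=
  trace_p u (i - 1) - lam / om1 * (incell fh u i - iface fh u (i - 1)).

(* The states over which U'' is maximized: the values of u and the states
   swept by the end-point updates. The values of u alone do not bound the
   second order remainder of U along these updates, as U'' may be arbitrarily
   large outside the range of u. *)
Definition entropy_states (lam om1 omN : R) (fh : R -> R -> R) u : set R :=
  [set v | exists i, [\/ exists2 x, cell i x & v = (u i).[x],
      between (trace_m u i) (right_update lam omN fh u i) v |
      between (trace_p u (i - 1)) (left_update lam om1 fh u i) v]].

(* lambda <= 2 omega / M * num / D ^ 2, with no restriction when the right-hand
   side has a zero denominator. *)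
Definition cfl_quotient (lam om M num D : R) : Prop :=
  M != 0 -> D != 0 -> lam <= 2 * om / M * (num / D ^+ 2).

Definition ES_theta (Uup U1st Uhigh : R) : R :=
  if Uhigh == U1st then 1 else Num.min ((Uup - U1st) / (Uhigh - U1st)) 1.

Definition ES_limiter (theta : int -> R) w : int -> {poly R} := fun i =>
  let wbar := (cell_average w i)%:P in wbar + theta i *: (w i - wbar).

End Discretization.

(* Main.v *)
(* Testing the scheme with w = 1 and integrating with the Gauss-Lobatto rule, whose
   weights are positive, writes the updated cell average as a convex combination
   of the nodal values of u in which the first and last nodes carry the flux
   differences fh_i - fh_{i-1/2} and fh_{i+1/2} - fh_i. At such a node a, with
   D = fh(a, b) - fh(c, a), Taylor expansion bounds the entropy of the updated
   value a - (lam / om) D by U(a) - (lam / om) U'(a) D + (M / 2) (lam / om)^2 D^2,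
   and the CFL condition absorbs the quadratic term in the entropy dissipation
   U'(a) D - (Fh(a, b) - Fh(c, a)), which is nonnegative by monotonicity of the
   flux. Jensen's inequality then gives U(ubar_i) <= Uup_i, so that theta_i lies
   in [0, 1], and the limiter preserves the bound by convexity along the segment
   joining ubar_i to the unlimited solution. *)
Require Import Defs.
From HB Require Import structures.
From mathcomp Require Import all_boot all_order all_algebra.
From mathcomp Require Import all_classical all_reals all_analysis.
From mathcomp Require Import ring lra zify.

Set Implicit Arguments.
Unset Strict Implicit.
Unset Printing Implicit Defensive.

Import Order.TTheory GRing.Theory Num.Theory.
Import numFieldNormedType.Exports.

Local Open Scope classical_set_scope.
Local Open Scope ring_scope.

(** * Convexity, second-order bounds and entropy dissipation of the numerical flux *)

Section Analysis.
Context {R : realType}.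
Implicit Types (f g U F : R -> R) (a b c x y : R).

Lemma betweenC a b : between a b = between b a.
Proof. by rewrite /between minC maxC. Qed.

Lemma between_mul_ge0 a b c : between a b c -> 0 <= (c - a) * (b - a).
Proof.
rewrite /between /= in_itv /=; case: (leP a b) => [ab|ba] /andP[h1 h2].
  by rewrite mulr_ge0 ?subr_ge0.
by rewrite mulr_le0 ?subr_le0 // ltW.
Qed.

Lemma between_trans a b c x : between a b c -> between a c x -> between a b x.
Proof.
rewrite /between /= !in_itv /= !ge_min !le_max.
case: (leP a b) => h /andP[h1 h2] /andP[/orP h3 /orP h4].
  by apply/andP; split; case: h3; case: h4; lra.
by apply/andP; split; case: h3; case: h4; lra.
Qed.

Lemma MVT_between f df a b : (forall x : R, is_derive x 1 f (df x)) ->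
  exists2 c, between a b c & f b - f a = df c * (b - a).
Proof.
move=> fdf.
have cf (x y : R) : {within `[x, y], continuous f}.
  by apply: derivable_within_continuous => z _; have [] := fdf z.
have [ab|/ltW ba] := leP a b.
  have [c cab E] := MVT_segment ab (fun x _ => fdf x) (cf a b).
  by exists c => //; rewrite /between min_l // max_r.
have [c cab E] := MVT_segment ba (fun x _ => fdf x) (cf b a).
exists c; first by rewrite /between min_r // max_l.
by rewrite -opprB E -mulrN opprB.
Qed.

(** The derivative is the limit of right difference quotients, all nonpositive for small steps.
    Steps below 1 suffice, which is the range given by convexity along a segment. *)
Lemma is_derive_le0_right f a d : is_derive a 1 f d ->
  (forall t, 0 < t -> t < 1 -> f (a + t) <= f a) -> d <= 0.
Proof.
move=> [df <-] fle.
have /cvg_ex[l hl] : derivable f a 1 := df.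
have -> : 'D_1 f a = l by exact: cvg_lim.
have hl' : h^-1 *: (f (h *: 1 + a) - f a) @[h --> 0^'+] --> l.
  by apply: cvg_trans hl; apply: cvg_app; apply: within_subset => r /= r0; rewrite gt_eqF.
have -> : l = lim (h^-1 *: (f (h *: 1 + a) - f a) @[h --> 0^'+]).
  by apply/esym/cvg_lim.
apply: limr_le; first by apply/cvg_ex; exists l.
near=> h.
have h0 : 0 < h by near: h; exact: nbhs_right_gt.
have h1 : h < 1 by near: h; exact: nbhs_right_lt.
rewrite pmulr_rle0 ?invr_gt0 // subr_le0 addrC.
by have := fle h h0 h1; rewrite -[h%:A]/(h * 1) mulr1.
Unshelve. all: by end_near. Qed.

Lemma convex_functionP U a b t : convex_function (setT : set R) U ->
  0 <= t -> t <= 1 -> U (a + t * (b - a)) <= U a + t * (U b - U a).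
Proof.
move=> cU t0 t1.
have ht : Itv.spec (@Itv.num_sem R) (Itv.Real `[0%Z, 1%Z]%R) t.
  by rewrite /= /Itv.num_sem /= in_itv /= t0 t1 !andbT ger0_real.
pose T : {i01 R} := Itv.mk ht.
have h : U (t * b + (1 - t) * a) <= t * U b + (1 - t) * U a.
  by have := cU T b a; rewrite !inE; apply.
by move: h; congr (U _ <= _); ring.
Qed.

(** By convexity [phi] on [0, 1] is largest at t = 0, so its derivative there, U'(a) (b - a) - (U(b)
    - U(a)), is nonpositive. *)
Lemma convex_tangent U a b : convex_function (setT : set R) U ->
  derivable U a 1 -> U a + derive1 U a * (b - a) <= U b.
Proof.
move=> cU dU.
pose phi t := U (a + t * (b - a)) - t * (U b - U a).
have dphi : is_derive (0 : R) 1 phi (derive1 U a * (b - a) - (U b - U a)).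
  have dUa : is_derive (a + 0 * (b - a)) 1 U (derive1 U a).
    by rewrite mul0r addr0 derive1E; exact: derivableP.
  have dg : is_derive (0 : R) 1 (fun t : R => a + t * (b - a)) (b - a).
    by apply: is_derive_eq; rewrite /GRing.scale /=; ring.
  have dl : is_derive (0 : R) 1 (fun t : R => t * (U b - U a)) (U b - U a).
    by apply: is_derive_eq; rewrite /GRing.scale /=; ring.
  have dc := @is_derive1_comp _ _ (fun t : R => a + t * (b - a)) (0 : R) _ _ dUa dg.
  exact: (is_deriveB dc dl).
have : derive1 U a * (b - a) - (U b - U a) <= 0.
  apply: (is_derive_le0_right dphi) => t t0 t1.
  rewrite add0r /phi mul0r addr0 mul0r subr0.
  by have := @convex_functionP U a b t cU (ltW t0) (ltW t1); lra.
lra.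
Qed.

Lemma convex_derive1_homo U a b : convex_function (setT : set R) U ->
  (forall x, derivable U x 1) ->
  0 <= (derive1 U b - derive1 U a) * (b - a).
Proof.
move=> cU dU.
have := convex_tangent b cU (dU a); have := convex_tangent a cU (dU b).
lra.
Qed.

(** U' is nondecreasing, so - U' does not exceed its value at a on the right of a. *)
Lemma convex_derive2_ge0 U a : convex_function (setT : set R) U -> C2 U ->
  0 <= derive1 (derive1 U) a.
Proof.
move=> cU [dU [ddU _]]; rewrite -oppr_le0.
have dd : is_derive a 1 (- derive1 U) (- derive1 (derive1 U) a).
  by apply: is_deriveN; rewrite derive1E; exact: derivableP.
apply: (is_derive_le0_right dd) => t t0 t1.
rewrite lerN2; have := convex_derive1_homo a (a + t) cU dU.
by rewrite [a + t]addrC addrK pmulr_lge0 // subr_ge0.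
Qed.

(** Two mean value steps replace the Lagrange remainder: [h] is U minus the quadratic majorant up to
    a constant, h(b) - h(a) = h'(c) (b - a) and h'(c) = (U''(d) - M) (c - a). Since (c - a) (b - a)
    is nonnegative, the order of a and b does not matter. *)
Lemma taylor2_le U M a b : C2 U ->
  (forall v, between a b v -> derive1 (derive1 U) v <= M) ->
  U b <= U a + derive1 U a * (b - a) + 2^-1 * M * (b - a) ^+ 2.
Proof.
move=> [dU [ddU _]] hM.
pose h x := U x - derive1 U a * x - 2^-1 * M * (x - a) ^+ 2.
pose g x := derive1 U x - M * x.
have dh x : is_derive x 1 h (derive1 U x - derive1 U a - M * (x - a)).
  have d1 : is_derive x 1 U (derive1 U x) by rewrite derive1E; exact: derivableP.
  by rewrite /h; apply: is_derive_eq; rewrite /GRing.scale /=; field.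
have dg x : is_derive x 1 g (derive1 (derive1 U) x - M).
  have d1 : is_derive x 1 (derive1 U) (derive1 (derive1 U) x).
    by rewrite derive1E; exact: derivableP.
  by rewrite /g; apply: is_derive_eq; rewrite /GRing.scale /=; ring.
have [c cab] := MVT_between a b dh.
have [d dac] := MVT_between a c dg.
have /(mulr_ge0 (between_mul_ge0 cab)) : 0 <= M - derive1 (derive1 U) d.
  by rewrite subr_ge0; exact: hM (between_trans cab dac).
rewrite /h /g => le0 e1 e2.
have {}e1 : derive1 U c - derive1 U a - M * (c - a) =
    (derive1 (derive1 U) d - M) * (c - a) by rewrite -e1; ring.
move: e2; rewrite e1; lra.
Qed.

(** Continuity of f' on a compact interval makes the set under the supremum bounded above. *)
Lemma LF_speed_ge f a b s : C1 f -> between a b s ->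
  `|derive1 f s| <= LF_speed f a b.
Proof.
move=> [_ cf] sab; apply: ub_le_sup; last by exists s.
have [||c cab cmax] := @EVT_max R (fun s => `|derive1 f s|) (Num.min a b) (Num.max a b).
- by rewrite ge_min !le_max lexx.
- apply: continuous_subspaceT => x.
  by apply: continuous_comp; [exact: cf|exact: norm_continuous].
- by exists `|derive1 f c| => _ [t tab <-]; exact: cmax.
Qed.

(* [r] is the entropy factor (U'(a) - U'(c)) (b - a), [c] a mean value point. *)
Lemma entropy_dissipation U (g G dg : R -> R) a b :
  convex_function (setT : set R) U -> (forall x, derivable U x 1) ->
  (forall s : R, is_derive s 1 g (dg s)) ->
  (forall s : R, is_derive s 1 G (derive1 U s * dg s)) ->
  exists2 c, between a b c & exists2 r, r <= 0 &
  derive1 U a * (g b - g a) - (G b - G a) = dg c * r.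
Proof.
move=> cU dU hg hG.
pose h x := derive1 U a * g x - G x.
have dh x : is_derive x 1 h ((derive1 U a - derive1 U x) * dg x).
  by rewrite /h; apply: is_derive_eq; rewrite /GRing.scale /=; ring.
have [c cab hc] := MVT_between a b dh.
exists c => //; exists ((derive1 U a - derive1 U c) * (b - a)); last first.
  by move: hc; rewrite /h; lra.
have := between_mul_ge0 cab; have := convex_derive1_homo a c cU dU.
move=> h1 h2; have [->|ca] := eqVneq c a; first by rewrite subrr mul0r.
move: (derive1 U a) (derive1 U c) h1 h2 => p q h1 h2.
(* The two sign facts share the factor c - a; in their product it appears squared and can be divided
   out. *)
have c0 : 0 < (c - a) ^+ 2 by rewrite exprn_even_gt0 ?subr_eq0.
rewrite -(pmulr_rle0 _ c0); have := mulr_ge0 h1 h2; lra.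
Qed.

Lemma is_derive_LF_form f g alpha a b : (forall x, derivable f x 1) ->
  (forall x, derivable g x 1) ->
  is_derive a 1 (fun s => LF_form f g alpha s b)
    (2^-1 * (derive1 f a + alpha * derive1 g a)) /\
  is_derive b 1 (fun s => LF_form f g alpha a s)
    (2^-1 * (derive1 f b - alpha * derive1 g b)).
Proof.
move=> df dg.
have d1 x : is_derive x 1 f (derive1 f x) by rewrite derive1E; exact: derivableP.
have d2 x : is_derive x 1 g (derive1 g x) by rewrite derive1E; exact: derivableP.
by split; rewrite /LF_form; apply: is_derive_eq; rewrite /GRing.scale /=; ring.
Qed.

(** The jump from fh(c, a) to fh(a, b) is split at the state (a, a): one path varies the first
    argument between c and a, the other the second between a and b. Each path contributes a
    derivative of the flux times an entropy factor of known sign. *)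
Lemma numerical_flux_dissipation f U F fh Fh fh1 fh2 a b c :
  C1 f -> entropy_pair f U F -> numerical_flux f U F fh Fh fh1 fh2 ->
  0 <= derive1 U a * (fh a b - fh c a) - Fh a b + Fh c a.
Proof.
move=> hf [cU [dU _] dF].
(* [g1] and [g2] stand for the two one-argument paths, [G1] and [G2] for their entropy counterparts.
   Signs are asked only between the end states, where the Lax-Friedrichs speed dominates the
   absolute value of f'. *)
suff H (g1 g2 G1 G2 dg1 dg2 : R -> R) :
  fh a b = g2 b -> fh c a = g1 c -> Fh a b = G2 b -> Fh c a = G1 c ->
  g1 a = g2 a -> G1 a = G2 a ->
  (forall s : R, is_derive s 1 g1 (dg1 s)) ->
  (forall s : R, is_derive s 1 G1 (derive1 U s * dg1 s)) ->
  (forall s : R, is_derive s 1 g2 (dg2 s)) ->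
  (forall s : R, is_derive s 1 G2 (derive1 U s * dg2 s)) ->
  (forall s, between a c s -> 0 <= dg1 s) ->
  (forall s, between a b s -> dg2 s <= 0) ->
  0 <= derive1 U a * (fh a b - fh c a) - Fh a b + Fh c a.
  case=> [[[_ _] _ dfh sgn dFh]|LF].
    apply: (H (fh ^~ a) (fh a) (Fh ^~ a) (Fh a) (fh1 ^~ a) (fh2 a)) => //;
      move=> s; by [have [] := dfh s a | have [] := dfh a s | have [] := dFh s a |
       have [] := dFh a s | have [] := sgn s a | have [] := sgn a s].
  have [e1 e2 _ _] := LF a b; have [e3 e4 _ _] := LF c a.
  have did (x : R) : derivable (@id R) x 1 by [].
  have dF' x : derivable F x 1 by have [] := dF x.
  have F'E x : derive1 F x = derive1 U x * derive1 f x.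
    by rewrite derive1E; have [_ ->] := dF x.
  have idE x : derive1 (@id R) x = 1 by rewrite derive1E derive_id.
  apply: (H (fun s => LF_form f id (LF_speed f c a) s a)
    (fun s => LF_form f id (LF_speed f a b) a s)
    (fun s => LF_form F U (LF_speed f c a) s a)
    (fun s => LF_form F U (LF_speed f a b) a s)
    (fun s => 2^-1 * (derive1 f s + LF_speed f c a))
    (fun s => 2^-1 * (derive1 f s - LF_speed f a b)) e1 e3 e2 e4).
  (* The two paths freeze different speeds, but at equal arguments the viscous term vanishes, so
     they still meet. *)
  - by rewrite /LF_form !subrr !mulr0.
  - by rewrite /LF_form !subrr !mulr0.
  - move=> s; have [+ _] := is_derive_LF_form (LF_speed f c a) s a hf.1 did.
    by rewrite idE mulr1.
  - move=> s; have [+ _] := is_derive_LF_form (LF_speed f c a) s a dF' dU.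
    by rewrite F'E; congr (is_derive _ _ _ _); ring.
  - move=> s; have [_ +] := is_derive_LF_form (LF_speed f a b) a s hf.1 did.
    by rewrite idE mulr1.
  - move=> s; have [_ +] := is_derive_LF_form (LF_speed f a b) a s dF' dU.
    by rewrite F'E; congr (is_derive _ _ _ _); ring.
  - move=> s; rewrite betweenC => /(LF_speed_ge hf); rewrite ler_norml => /andP[].
    lra.
  - move=> s /(LF_speed_ge hf); rewrite ler_norml => /andP[]; lra.
move=> -> -> -> -> g12 G12 dg1E dG1E dg2E dG2E s1 s2.
have [x xb [r r0]] := entropy_dissipation a b cU dU dg2E dG2E.
have [y yb [t t0]] := entropy_dissipation a c cU dU dg1E dG1E.
have := mulr_le0 (s2 _ xb) r0; have := mulr_ge0_le0 (s1 _ yb) t0.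
rewrite g12 G12; lra.
Qed.

(** Serves both ends of a cell: at the right end fh(a, b) is the interface flux and fh(c, a) the
    in-cell one; at the left end the roles are exchanged. *)
Lemma endpoint_entropy f U F fh Fh fh1 fh2 (lam om M a b c : R) :
  C1 f -> entropy_pair f U F -> numerical_flux f U F fh Fh fh1 fh2 ->
  0 < lam -> 0 < om ->
  let D := fh a b - fh c a in
  (forall v, between a (a - lam / om * D) v -> derive1 (derive1 U) v <= M) ->
  cfl_quotient lam om M (derive1 U a * D - Fh a b + Fh c a) D ->
  U (a - lam / om * D) <= U a - lam / om * (Fh a b - Fh c a).
Proof.
move=> hf hUF hflux lam0 om0 D hM cfl.
have := numerical_flux_dissipation a b c hf hUF hflux.
have [cU C2U _] := hUF.
rewrite -/D => num0.
have M0 : 0 <= M.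
  apply: le_trans (convex_derive2_ge0 a cU C2U) (hM _ _).
  by rewrite /between /= in_itv /= ge_min le_max lexx.
have := taylor2_le C2U hM.
have -> : a - lam / om * D - a = - (lam / om * D) by ring.
move=> /le_trans; apply.
set r := lam / om.
have r0 : 0 < r by rewrite divr_gt0.
suff : 2^-1 * M * r * D ^+ 2 <= derive1 U a * D - Fh a b + Fh c a.
  by move/(ler_wpM2l (ltW r0)); lra.
(* If M or D is zero, [cfl_quotient] gives no information, but the quadratic term vanishes and
   nonnegative dissipation suffices. *)
have [->|M_neq0] := eqVneq M 0; first by rewrite mulr0 !mul0r.
have [D0|D_neq0] := eqVneq D 0; first by rewrite {1}D0 expr0n /= mulr0.
have M_gt0 : 0 < M by rewrite lt_def M_neq0.
have := cfl M_neq0 D_neq0.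
have D2 : 0 < D ^+ 2 by rewrite exprn_even_gt0.
rewrite mulrA ler_pdivlMr // mulrAC ler_pdivlMr // => h.
rewrite -(ler_pM2l (_ : 0 < 2 * om)) ?mulr_gt0 //.
apply: le_trans h; rewrite le_eqVlt; apply/orP; left; apply/eqP.
by rewrite /r; field; rewrite gt_eqF.
Qed.
End Analysis.

(** * Gauss-Lobatto rule: positive weights and exact cell averages *)

Section Quadrature.
Context {R : realType}.
Implicit Types (p w : {poly R}) (xi om : nat -> R).

Lemma poly_antiderivative p : exists P, deriv P = p.
Proof.
(* At i = 0 the coefficient is a division by zero, hence 0: this fixes the constant of
   integration. *)
exists (\poly_(i < (size p).+1) (p`_i.-1 / i%:R)).
apply/polyP => i; rewrite coef_deriv coef_poly ltnS /=.
case: ltnP => [_|/(nth_default 0) ->]; last by rewrite mul0rn.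
by rewrite -[LHS]mulr_natr divfK // pnatr_eq0.
Qed.

Lemma Rintegral_deriv_horner p (a b : R) : a < b ->
  \int[lebesgue_measure]_(x in `[a, b]) (deriv p).[x] = p.[b] - p.[a].
Proof.
move=> ab; rewrite /Rintegral (@continuous_FTC2 _ _ (horner p)) //.
- by apply: continuous_subspaceT; exact: continuous_horner.
- split=> [x _| |]; first exact: derivable_horner.
    by apply: cvg_at_right_filter; exact: continuous_horner.
  by apply: cvg_at_left_filter; exact: continuous_horner.
- by move=> x _; rewrite derivE.
Qed.

(** An antiderivative increases strictly over [0, c] and does not decrease over [c, 1]. *)
Lemma Rintegral_horner_gt0 p (c : R) : 0 < c -> c <= 1 ->
  (forall x, 0 <= x -> x <= 1 -> 0 <= p.[x]) ->
  (forall x, 0 < x -> x < c -> 0 < p.[x]) ->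
  0 < \int[lebesgue_measure]_(x in `[0%R, 1%R]) p.[x].
Proof.
move=> c0 c1 p_ge0 p_gt0; have [P PE] := poly_antiderivative p.
rewrite -PE Rintegral_deriv_horner //.
have dP (x : R) : is_derive x 1 (horner P) p.[x] by rewrite -PE; exact: is_derive_poly.
have cP (x y : R) : {within `[x, y], continuous (horner P)}.
  by apply: continuous_subspaceT; exact: continuous_horner.
have [z + E1] := MVT c0 (fun x _ => dP x) (cP 0 c).
have [t + E2] := MVT_segment c1 (fun x _ => dP x) (cP c 1).
rewrite !in_itv /= => /andP[ct t1] /andP[z0 zc].
rewrite -(subrK P.[c] P.[1]) E2 -addrA E1 subr0 ltr_wpDl //.
  by rewrite mulr_ge0 ?subr_ge0 // p_ge0 // (le_trans (ltW c0)).
by rewrite mulr_gt0 // p_gt0.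
Qed.

Lemma size_prod_degree (I : Type) (r : seq I) (P : pred I) (F : I -> {poly R}) :
  ((size (\prod_(j <- r | P j) F j)%R).-1 <= \sum_(j <- r | P j) (size (F j)).-1)%N.
Proof.
apply: (big_ind2 (fun (x : {poly R}) (n : nat) => (size x).-1 <= n)%N) => //.
  by rewrite size_poly1.
move=> x m y n hx hy; have := size_polyMleq x y; lia.
Qed.

Section Weights.
Variables (N : nat) (xi om : nat -> R).
Hypotheses (N2 : (2 <= N)%N) (hGL : gauss_lobatto N xi om).

(* The product of [fac j] over j != q has degree at most 2N - 3, is nonnegative on
   [0, 1] and vanishes at every node but [xi q]. *)
Let fac j : {poly R} :=
  if j == 1%N then 'X else if j == N then 1 - 'X else ('X - (xi j)%:P) ^+ 2.

Let xi_inj q j : (0 < q <= N)%N -> (0 < j <= N)%N -> q != j -> xi q != xi j.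
Proof.
have [_ _ hlt _] := hGL => /andP[q0 qN] /andP[j0 jN].
case: (ltngtP q j) => // h _.
  by rewrite lt_eqF // hlt.
by rewrite gt_eqF // hlt.
Qed.

Let xi_itv q : (0 < q <= N)%N -> 0 <= xi q <= 1.
Proof.
have [x1 xN hlt _] := hGL => /andP[q0 qN]; apply/andP; split.
  rewrite -x1; case: (ltnP 1 q) => h; first by rewrite ltW // hlt.
  by have -> : q = 1%N by lia.
rewrite -xN; case: (ltnP q N) => h; first by rewrite ltW // hlt.
by have -> : q = N by lia.
Qed.

Let fac_root j : (fac j).[xi j] = 0.
Proof.
have [x1 xN _ _] := hGL; rewrite /fac.
case: eqP => [->|_]; first by rewrite hornerX.
case: eqP => [->|_]; first by rewrite !hornerE xN subrr.
by rewrite horner_exp !hornerE subrr expr0n.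
Qed.

Let fac_gt0 j x : 0 <= x -> x <= 1 -> x != xi j -> 0 < (fac j).[x].
Proof.
have [x1 xN _ _] := hGL; rewrite /fac => x_ge0 x_le1.
case: (j =P 1%N) => [->|_]; first by rewrite hornerX x1 lt_def => ->.
case: (j =P N) => [->|_]; first by rewrite !hornerE xN subr_gt0 lt_neqAle => ->.
by rewrite horner_exp !hornerE => h; rewrite exprn_even_gt0 //= subr_eq0.
Qed.

Let fac_ge0 j x : 0 <= x -> x <= 1 -> 0 <= (fac j).[x].
Proof.
move=> x0 x1; have [->|h] := eqVneq x (xi j); first by rewrite fac_root.
by rewrite ltW // fac_gt0.
Qed.

Let size_fac j : ((size (fac j)).-1 = if (j == 1%N) || (j == N) then 1 else 2)%N.
Proof.
rewrite /fac; case: eqP => _ /=; first by rewrite size_polyX.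
case: eqP => _ /=; last by rewrite size_exp_XsubC.
by rewrite -opprB size_polyN -polyC1 size_XsubC.
Qed.

(** Two end-point factors of degree 1 and N - 2 interior ones of degree 2. Dropping any factor
    leaves degree at most 2N - 3, within the exactness of the rule. *)
Let sum_degree : (\sum_(1 <= j < N.+1) (size (fac j)).-1 = 2 * N - 2)%N.
Proof.
rewrite big_nat_recr /=; last lia.
rewrite big_ltn //= !size_fac !eqxx orbT /=.
rewrite (eq_big_nat _ _ (F2 := fun=> 2%N)) ?sum_nat_const_nat; first lia.
by move=> j hj; rewrite size_fac; case: eqP => /=; [lia|]; case: eqP => /=; lia.
Qed.

(** For the product [p] of the factors other than q, exactness reads om_q p(xi_q) = integral of p,
    where the integral and p(xi_q) are both positive. *)
Lemma gauss_lobatto_weight_gt0 q : (0 < q <= N)%N -> 0 < om q.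
Proof.
move=> hq; have [x1 xN hlt exact] := hGL.
pose p := \prod_(1 <= j < N.+1 | j != q) fac j.
have pE x : p.[x] = \prod_(1 <= j < N.+1 | j != q) (fac j).[x].
  by rewrite horner_prod.
have size_p : (size p <= 2 * N - 2)%N.
  have := size_prod_degree (index_iota 1 N.+1) (fun j => j != q) fac.
  have := sum_degree; rewrite (bigD1_seq q) ?iota_uniq //=; last first.
    by rewrite mem_index_iota; lia.
  rewrite size_fac -/p; case: ifP => _; lia.
have p_gt0 : 0 < \int[lebesgue_measure]_(x in `[0%R, 1%R]) p.[x].
  (* No node lies strictly between xi_1 = 0 and xi_2, so no factor vanishes there. *)
  apply: (@Rintegral_horner_gt0 p (xi 2)).
  - by rewrite -x1 hlt.
  - by have /andP[] := @xi_itv 2 N2.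
  - by move=> x x0 xle; rewrite pE; apply: prodr_ge0 => j _; exact: fac_ge0.
  - move=> x x0 xlt; rewrite pE big_seq_cond; apply: prodr_gt0 => j.
    rewrite mem_index_iota => /andP[hj _].
    have xi2 := xi_itv (q := 2) N2.
    apply: fac_gt0; [exact: ltW|lra|].
    have [->|j1] := eqVneq j 1%N; first by rewrite x1 gt_eqF.
    rewrite lt_eqF // (lt_le_trans xlt) //.
    have [->//|j2] := eqVneq j 2%N.
    by rewrite ltW // hlt; lia.
move: p_gt0; rewrite -exact // (bigD1_seq q) ?iota_uniq //=; last first.
  by rewrite mem_index_iota; lia.
rewrite big_seq_cond big1 ?addr0; last first.
  move=> j; rewrite mem_index_iota => /andP[hj jq].
  apply/eqP; rewrite mulf_eq0 pE prodf_seq_eq0; apply/orP; right.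
  by apply/hasP; exists j; rewrite ?mem_index_iota // jq fac_root eqxx.
rewrite pmulr_lgt0 // pE big_seq_cond; apply: prodr_gt0 => j.
rewrite mem_index_iota => /andP[hj jq].
have /andP[h1 h2] := xi_itv hq.
apply: fac_gt0 => //; rewrite eq_sym; apply: xi_inj => //.
Qed.

Lemma gauss_lobatto_sum_weights : \sum_(1 <= q < N.+1) om q = 1.
Proof.
have [_ _ _ /(_ 1)] := hGL; rewrite size_poly1 => /(_ _).
have -> : \int[lebesgue_measure]_(x in `[0%R, 1%R]) (1 : {poly R}).[x] = 1 :> R.
  by rewrite -(derivX R) Rintegral_deriv_horner // !hornerX subr0.
move=> <-; last lia.
by apply: eq_bigr => q _; rewrite hornerC mulr1.
Qed.

(** The affine change of variables is done on antiderivatives: if W' is the polynomial on the cell,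
    W composed with [phi] and divided by dx is an antiderivative on the unit interval. *)
Lemma cell_average_lobatto (x0 dx : R) (w : int -> {poly R}) i : 0 < dx ->
  (size (w i) <= 2 * N - 2)%N ->
  cell_average x0 dx w i =
  \sum_(1 <= q < N.+1) om q * (w i).[node x0 dx i + dx * xi q].
Proof.
move=> dx0 sw; have [_ _ _ exact] := hGL.
pose phi : {poly R} := dx *: 'X + (node x0 dx i)%:P.
have phiE x : phi.[x] = node x0 dx i + dx * x.
  by rewrite hornerD hornerZ hornerX hornerC addrC.
have size_phi : size phi = 2%N.
  by rewrite /phi -mul_polyC size_MXaddC polyC_eq0 gt_eqF //= size_polyC gt_eqF.
under eq_bigr do rewrite -phiE -horner_comp.
have [W WE] := poly_antiderivative (w i).
rewrite exact; last by rewrite size_comp_poly2.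
have -> : w i \Po phi = deriv (dx^-1 *: (W \Po phi)).
  rewrite derivZ deriv_comp WE /phi derivD derivZ derivX derivC addr0.
  by rewrite -scalerAr scalerA mulVf ?gt_eqF // scale1r mulr1.
rewrite Rintegral_deriv_horner // /cell_average /cell -WE Rintegral_deriv_horner.
  rewrite !hornerZ !horner_comp !phiE mulr0 addr0 -mulrBr.
  by congr (_ * (_.[_] - _)); rewrite /node; ring.
by rewrite /node intrD; nra.
Qed.
End Weights.
End Quadrature.

(** * Jensen's inequality, the entropy of the cell average and the limiter *)

Section Limiter.
Context {R : realType}.
Implicit Types (U : R -> R) (om y : nat -> R).

(** The weighted tangent inequalities at the mean [m] are summed; their linear terms cancel. *)
Lemma jensen U N om y : convex_function (setT : set R) U ->
  (forall x : R, derivable U x 1) ->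
  (forall q, (0 < q <= N)%N -> 0 <= om q) -> \sum_(1 <= q < N.+1) om q = 1 ->
  U (\sum_(1 <= q < N.+1) om q * y q) <= \sum_(1 <= q < N.+1) om q * U (y q).
Proof.
move=> cU dU om_ge0 om1; set m := \sum_(1 <= q < N.+1) om q * y q.
have -> : U m = \sum_(1 <= q < N.+1) om q * (U m + derive1 U m * (y q - m)).
  under eq_bigr => q _ do
    rewrite mulrDr mulrBr mulrDr mulrN !(mulrCA (om q)).
  rewrite big_split sumrB /= -!mulr_sumr -/m -!mulr_suml om1; ring.
apply: ler_sum_nat => q hq; apply: ler_wpM2l; first exact: om_ge0.
exact: convex_tangent.
Qed.

Lemma sum_indicator N om r (c : R) : (0 < r <= N)%N -> om r != 0 ->
  \sum_(1 <= q < N.+1) om q * (if q == r then c / om q else 0) = c.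
Proof.
move=> hr om0; rewrite (eq_bigr (fun q => if q == r then c else 0)).
  by rewrite -big_mkcond big_nat1_eq ltnS hr.
by move=> q _; case: eqP => [->|_]; rewrite ?mulr0 // mulrC divfK.
Qed.

(** The flux differences are charged to the first and last nodes, divided by their weights (d for
    the solution, e for the entropy). The averaged update becomes a convex combination of nodal
    updates, to which Jensen's inequality applies. *)
Lemma average_entropy U N om y (d1 dN e1 eN : R) :
  convex_function (setT : set R) U -> (forall x : R, derivable U x 1) ->
  (2 <= N)%N -> (forall q, (0 < q <= N)%N -> 0 < om q) ->
  \sum_(1 <= q < N.+1) om q = 1 ->
  U (y 1%N - d1 / om 1%N) <= U (y 1%N) - e1 / om 1%N ->
  U (y N - dN / om N) <= U (y N) - eN / om N ->
  U (\sum_(1 <= q < N.+1) om q * y q - (d1 + dN)) <=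
  \sum_(1 <= q < N.+1) om q * U (y q) - (e1 + eN).
Proof.
move=> cU dU N2 om_gt0 om1 h1 hN.
pose upd c cN (z : nat -> R) q := z q -
  ((if q == 1%N then c / om q else 0) + (if q == N then cN / om q else 0)).
have updE c cN z : \sum_(1 <= q < N.+1) om q * z q - (c + cN) =
    \sum_(1 <= q < N.+1) om q * upd c cN z q.
  under [RHS]eq_bigr do rewrite /upd mulrBr mulrDr.
  by rewrite sumrB big_split /= !sum_indicator // ?gt_eqF ?om_gt0 //; lia.
rewrite updE (updE e1 eN (U \o y)); apply: le_trans (jensen _ cU dU _ om1) _.
  by move=> q hq; rewrite ltW // om_gt0.
apply: ler_sum_nat => q hq; apply: ler_wpM2l; first by rewrite ltW // om_gt0.
(* Since N is at least 2, no node carries both corrections. *)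
rewrite /upd /=; have [q1|_] := eqVneq q 1%N; have [qN|_] := eqVneq q N.
- lia.
- by rewrite q1 !addr0.
- by rewrite qN !add0r.
- by rewrite !addr0 !subr0.
Qed.

Lemma cell_entropyE (x0 dx : R) N xi om U (w : int -> {poly R}) i : dx != 0 ->
  cell_entropy x0 dx N xi om U w i =
  \sum_(1 <= q < N.+1) om q * U (w i).[node x0 dx i + dx * xi q].
Proof. by move=> dx0; rewrite /cell_entropy /lobatto_integral mulKf. Qed.

(** The quotient in [ES_theta] is where the linear interpolation from U1 to Uh reaches Uup; the
    minimum with 1 can only lower the interpolated value. *)
Lemma ES_theta_itv (Uup U1 Uh : R) : U1 <= Uup -> U1 <= Uh ->
  [/\ 0 <= ES_theta Uup U1 Uh, ES_theta Uup U1 Uh <= 1 &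
      U1 + ES_theta Uup U1 Uh * (Uh - U1) <= Uup].
Proof.
move=> h1 h2; rewrite /ES_theta; have [->|ne] := eqVneq Uh U1.
  by split; rewrite // subrr mulr0 addr0.
have hlt : 0 < Uh - U1 by rewrite subr_gt0 lt_def ne.
split; first by rewrite le_min ler01 andbT divr_ge0 ?subr_ge0.
  by rewrite ge_min lexx orbT.
by rewrite -lerBrDl -ler_pdivlMr // ge_min lexx.
Qed.

(** At each node the limited value lies on the segment from the cell average to the unlimited value;
    the convexity inequalities are summed with weights of total 1. *)
Lemma limited_entropy (x0 dx : R) N xi om U theta (w : int -> {poly R}) i :
  dx != 0 -> convex_function (setT : set R) U ->
  (forall q, (0 < q <= N)%N -> 0 <= om q) -> \sum_(1 <= q < N.+1) om q = 1 ->
  0 <= theta i -> theta i <= 1 ->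
  cell_entropy x0 dx N xi om U (ES_limiter x0 dx theta w) i <=
  U (cell_average x0 dx w i) + theta i *
    (cell_entropy x0 dx N xi om U w i - U (cell_average x0 dx w i)).
Proof.
move=> dx0 cU om_ge0 om1 t0 t1; rewrite !cell_entropyE //.
set m := cell_average x0 dx w i; set t := theta i.
have -> : U m + t * (\sum_(1 <= q < N.+1)
      om q * U (w i).[node x0 dx i + dx * xi q] - U m) =
    \sum_(1 <= q < N.+1)
      om q * (U m + t * (U (w i).[node x0 dx i + dx * xi q] - U m)).
  under [RHS]eq_bigr => q _ do
    rewrite mulrDr mulrBr mulrDr mulrN !(mulrCA (om q)).
  rewrite big_split sumrB /= -!mulr_sumr -!mulr_suml om1; ring.
apply: ler_sum_nat => q hq; apply: ler_wpM2l; first exact: om_ge0.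
rewrite /ES_limiter hornerD hornerZ hornerD hornerN hornerC.
exact: convex_functionP.
Qed.

Lemma trace_pB1 (x0 dx : R) (u : int -> {poly R}) i :
  trace_p x0 dx u (i - 1) = (u i).[node x0 dx i].
Proof. by rewrite /trace_p subrK. Qed.

(** The test function 1 has zero derivative and unit traces, so only the two interface fluxes
    remain. *)
Lemma DG_cell_average (x0 dx dt : R) k f fh (u Lu : int -> {poly R}) i :
  DG_operator x0 dx k f fh u Lu ->
  dt * cell_average x0 dx Lu i =
  - (dt / dx * (iface x0 dx fh u i - iface x0 dx fh u (i - 1))).
Proof.
move=> [_ hLu]; have := hLu (fun=> 1) _ i.
rewrite trace_pB1 /trace_m -polyC1 derivC !hornerC !mulr1.
under eq_Rintegral do rewrite hornerC mulr1.
under [X in _ = X - _ + _]eq_Rintegral do rewrite hornerC mulr0.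
rewrite [X in _ = X - _ + _](_ : _ = 0) ?sub0r; last by rewrite /Rintegral integral0.
move=> H.
rewrite /cell_average H; first by ring.
by move=> j; rewrite size_poly1.
Qed.

End Limiter.

(** * Assembly on one cell: average update, end-point bounds, limiter *)

Theorem theorem3p8 (R : realType) (k N : nat) (x0 dx dt lam M : R)
  (f U F : R -> R) (fh Fh fh1 fh2 : R -> R -> R) (xi om : nat -> R)
  (u Lu upre : int -> {poly R}) (ubar Uup theta : int -> R)
  (hdx : 0 < dx) (hdt : 0 < dt) (hlam : lam = dt / dx)
  (hf : C1 f)
  (hUF : entropy_pair f U F)
  (hflux : numerical_flux f U F fh Fh fh1 fh2)
  (hN : (k + 3 <= 2 * N)%N)
  (hGL : gauss_lobatto N xi om)
  (hu : Vh k u)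
  (hLu : DG_operator x0 dx k f fh u Lu)
  (hupre : forall i : int, upre i = u i + dt *: Lu i)
  (hMbnd : has_ubound
     (derive1 (derive1 U) @` entropy_states x0 dx lam (om 1%N) (om N) fh u))
  (hM : M = sup
     (derive1 (derive1 U) @` entropy_states x0 dx lam (om 1%N) (om N) fh u))
  (hcfl1 : forall i : int, lam <= iface x0 dx fh1 u i - incell x0 dx fh2 u i)
  (hcfl2 : forall i : int, lam <= incell x0 dx fh1 u i - iface x0 dx fh2 u (i - 1))
  (hcfl3 : forall i : int, cfl_quotient lam (om N) M
     (derive1 U (trace_m x0 dx u i) * (iface x0 dx fh u i - incell x0 dx fh u i)
        - iface x0 dx Fh u i + incell x0 dx Fh u i)
     (iface x0 dx fh u i - incell x0 dx fh u i))
  (hcfl4 : forall i : int, cfl_quotient lam (om 1%N) M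
     (derive1 U (trace_p x0 dx u (i - 1))
          * (incell x0 dx fh u i - iface x0 dx fh u (i - 1))
        - incell x0 dx Fh u i + iface x0 dx Fh u (i - 1))
     (incell x0 dx fh u i - iface x0 dx fh u (i - 1)))
  (hubar : forall i : int, ubar i = cell_average x0 dx upre i)
  (hUup : forall i : int, Uup i = cell_entropy x0 dx N xi om U u i
     - lam * (iface x0 dx Fh u i - iface x0 dx Fh u (i - 1)))
  (htheta : forall i : int, theta i =
     ES_theta (Uup i) (U (ubar i)) (cell_entropy x0 dx N xi om U upre i)) :
  forall i : int,
    cell_entropy x0 dx N xi om U (ES_limiter x0 dx theta upre) i <= Uup i.
Proof.
move=> i.
have [cU C2U _] := hUF; have dU := C2U.1.
have N2 : (2 <= N)%N by lia.
have om_gt0 := gauss_lobatto_weight_gt0 N2 hGL.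
have om_ge0 q : (0 < q <= N)%N -> 0 <= om q by move=> /om_gt0/ltW.
have om_sum := gauss_lobatto_sum_weights N2 hGL.
have dx_neq0 : dx != 0 by rewrite gt_eqF.
have lam0 : 0 < lam by rewrite hlam divr_gt0.
have om1_gt0 : 0 < om 1%N by apply: om_gt0; lia.
have omN_gt0 : 0 < om N by apply: om_gt0; lia.
have sup_ge v : entropy_states x0 dx lam (om 1%N) (om N) fh u v ->
    derive1 (derive1 U) v <= M.
  by move=> hv; rewrite hM; apply: ub_le_sup => //; exists v.
(* Degree k is at most 2N - 3, so the rule computes cell averages of the discrete space exactly. *)
have avgE (w : int -> {poly R}) : (size (w i) <= k.+1)%N -> cell_average x0 dx w i =
    \sum_(1 <= q < N.+1) om q * (w i).[node x0 dx i + dx * xi q].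
  move=> sw; apply: (cell_average_lobatto hGL) => //.
  by rewrite (leq_trans sw) //; lia.
have size_upre : (size (upre i) <= k.+1)%N.
  rewrite hupre (leq_trans (size_polyD _ _)) // geq_max hu.
  by rewrite (leq_trans (size_scale_leq _ _)) //; exact: hLu.1.
(* Linearity of the cell average is read off the quadrature sums. *)
have upreE : ubar i = cell_average x0 dx u i -
    lam * (iface x0 dx fh u i - iface x0 dx fh u (i - 1)).
  rewrite hubar hlam -(DG_cell_average dt i hLu) !avgE //; last exact: hLu.1.
  rewrite hupre mulr_sumr -big_split /=; apply: eq_bigr => q _.
  by rewrite hornerD hornerZ; ring.
have left_le : U (left_update x0 dx lam (om 1%N) fh u i) <= U (trace_p x0 dx u (i - 1)) -
    lam / om 1%N * (incell x0 dx Fh u i - iface x0 dx Fh u (i - 1)).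
  apply: (endpoint_entropy hf hUF hflux lam0 om1_gt0 (M := M)); last exact: hcfl4.
  by move=> v hv; apply: sup_ge; exists i; exact: Or33.
have right_le : U (right_update x0 dx lam (om N) fh u i) <= U (trace_m x0 dx u i) -
    lam / om N * (iface x0 dx Fh u i - incell x0 dx Fh u i).
  apply: (endpoint_entropy hf hUF hflux lam0 omN_gt0 (M := M)); last exact: hcfl3.
  by move=> v hv; apply: sup_ge; exists i; exact: Or32.
have first_order : U (ubar i) <= Uup i.
  pose y q := (u i).[node x0 dx i + dx * xi q].
  have [x1 xN _ _] := hGL.
  have y1 : y 1%N = trace_p x0 dx u (i - 1).
    by rewrite /y x1 mulr0 addr0 trace_pB1.
  have yN : y N = trace_m x0 dx u i.
    by rewrite /y xN mulr1 /trace_m; congr (_.[_]); rewrite /node intrD; ring.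
  have := @average_entropy _ U N om y
    (lam * (incell x0 dx fh u i - iface x0 dx fh u (i - 1)))
    (lam * (iface x0 dx fh u i - incell x0 dx fh u i))
    (lam * (incell x0 dx Fh u i - iface x0 dx Fh u (i - 1)))
    (lam * (iface x0 dx Fh u i - incell x0 dx Fh u i)) cU dU N2 om_gt0 om_sum.
  rewrite y1 yN !(mulrAC lam _ (om _)^-1) => /(_ left_le right_le).
  (* The in-cell flux, subtracted at one end and added at the other, cancels and leaves the
     interface difference, for the flux and for the entropy flux. *)
  rewrite -!mulrDr ![incell _ _ _ _ _ - _ + _]addrC !subrKA.
  by rewrite upreE avgE // hUup cell_entropyE.
(* By exactness [ubar i] is the weighted mean of the nodal values of [upre i]; this makes the
   denominator in [theta] nonnegative. *)
have high_ge : U (ubar i) <= cell_entropy x0 dx N xi om U upre i.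
  by rewrite hubar avgE // cell_entropyE //; exact: jensen.
have [t0 t1 le_up] := ES_theta_itv first_order high_ge.
rewrite -htheta in t0 t1 le_up.
apply: le_trans (limited_entropy x0 xi upre dx_neq0 cU om_ge0 om_sum t0 t1) _.
by rewrite -hubar.
Qed.
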